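(* If $m$ in $\mathcal{O}$ is irreducible with norm $N(m)$ a prime congruent to $4$ or $7$ modulo $9$, then no associate $M$ of $m$ or of $m^{2}$ is of the form $x^{3}+y^{3}$ with $x$ and $y$ in $\mathcal{K}$.
   Context: Let $u$ and $v$ be the two roots in $\mathbb{C}$ of $z^{2}+z+1=0$ (so $u,v$ are the primitive cube roots of unity). $\mathcal{O}$ is the set of $\mathbb{Z}$-linear combinations of $1,u,v$ (the ring of Eisenstein integers) and $\mathcal{K}$ is the set of $\mathbb{Q}$-linear combinations of $1,u,v$ (its field of fractions). The norm is $N(w)=w\bar w=|w|^2$. Two elements of $\mathcal{O}$ are associates if each is the product of the other by a unit of $\mathcal{O}$; the units are $\pm1,\pm u,\pm v$. *)

(* Defs.v *)
From HB Require Import structures.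
From mathcomp Require Import all_boot all_order all_algebra.
From mathcomp Require Import complex.
From mathcomp Require Import reals.
Set Implicit Arguments.
Unset Strict Implicit.
Unset Printing Implicit Defensive.
Import Order.TTheory GRing.Theory Num.Theory.
Local Open Scope ring_scope.

(* In the definitions below, u and v are meant to be the two roots of
   z^2 + z + 1; O and K are then the Eisenstein integers and their field of
   fractions, as subsets of the complex numbers. *)
Definition in_O (C : numClosedFieldType) (u v w : C) : Prop :=
  exists a b c : int, w = a%:~R + b%:~R * u + c%:~R * v.

Definition in_K (C : numClosedFieldType) (u v w : C) : Prop :=
  exists a b c : rat, w = ratr a + ratr b * u + ratr c * v.

(* w * w^* is real, but it is kept as an element of C. *)
Definition normN (C : numClosedFieldType) (w : C) : C := w * w^*.

(* Units are those of the ring O, not GRing.unit of the ambient field C. *)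
Definition unit_O (C : numClosedFieldType) (u v e : C) : Prop :=
  in_O u v e /\ exists2 f, in_O u v f & e * f = 1.

Definition associate_O (C : numClosedFieldType) (u v a b : C) : Prop :=
  [/\ in_O u v a, in_O u v b,
      exists2 e, unit_O u v e & a = e * b
    & exists2 e, unit_O u v e & b = e * a].

Definition irreducible_O (C : numClosedFieldType) (u v m : C) : Prop :=
  [/\ in_O u v m, m <> 0, ~ unit_O u v m
    & forall a b : C, in_O u v a -> in_O u v b -> m = a * b ->
        unit_O u v a \/ unit_O u v b].

(* Main.v *)
Require Import Defs.
From HB Require Import structures.
From mathcomp Require Import all_boot all_order all_algebra.
From mathcomp Require Import complex.
From mathcomp Require Import reals.
From mathcomp Require Import finfield ring lra zify.
Set Implicit Arguments.
Unset Strict Implicit.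
Unset Printing Implicit Defensive.
Import Order.TTheory GRing.Theory Num.Theory.
Local Open Scope ring_scope.

(** Let [M = e q^j] with [e] a unit, [q] of norm [p] and [j = 1, 2]. A solution
    of [x^3 + y^3 = M z^3] with [z <> 0] descends. The factors [x + y],
    [omega (x + omega y)], [omega^2 (x + omega^2 y)] have sum zero, and once
    common factors are removed they are pairwise coprime, so [M] divides one of
    them and they are [e1 r^3], [e2 s^3], [e3 M t^3] with [e1 e2 e3] a cube.
    Modulo [q] the unit [e2 / e1] becomes a cube. As [p] is not [1] mod [9],
    [omega] is not a cube in [F_p], so [e2 = +- e1], hence also [e3 = +- e1],
    and [r^3 +- s^3 = +- M t^3] is a solution in which [t] has smaller norm than
    [z]. *)

(** * The ring of Eisenstein integers and its norm *)

(* [(a, b)] stands for the Eisenstein integer [a + b omega], omega^2 = -1 - omega. *)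
Definition eis : Type := (int * int)%type.
HB.instance Definition _ := GRing.Zmodule.on eis.

Definition eis_mul (x y : eis) : eis :=
  (x.1 * y.1 - x.2 * y.2, x.1 * y.2 + x.2 * y.1 - x.2 * y.2).

Fact eis_mulA : associative eis_mul.
Proof. by move=> x y z; apply: injective_projections => /=; ring. Qed.
Fact eis_mulC : commutative eis_mul.
Proof. by move=> x y; apply: injective_projections => /=; ring. Qed.
Fact eis_mul1 : left_id (1, 0) eis_mul.
Proof. by move=> x; apply: injective_projections => /=; ring. Qed.
Fact eis_mulDl : left_distributive eis_mul +%R.
Proof. by move=> x y z; apply: injective_projections => /=; ring. Qed.
Fact eis_1neq0 : (1, 0) != 0 :> eis.
Proof. by []. Qed.
HB.instance Definition _ := GRing.Zmodule_isComNzRing.Build eis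
  eis_mulA eis_mulC eis_mul1 eis_mulDl eis_1neq0.

Definition eis_normz (x : eis) : int := x.1 ^+ 2 - x.1 * x.2 + x.2 ^+ 2.
Definition eis_norm (x : eis) : nat := `|eis_normz x|%N.
Definition eis_conj (x : eis) : eis := (x.1 - x.2, - x.2).

Lemma eis_normzM x y : eis_normz (x * y) = eis_normz x * eis_normz y.
Proof. by rewrite /eis_normz /=; ring. Qed.

Lemma eis_normE x : (eis_norm x)%:Z = eis_normz x.
Proof.
rewrite /eis_norm gez0_abs // /eis_normz; nra.
Qed.

Lemma eis_normM x y : eis_norm (x * y) = (eis_norm x * eis_norm y)%N.
Proof. by rewrite /eis_norm eis_normzM abszM. Qed.

Lemma eis_norm_eq0 x : (eis_norm x == 0)%N = (x == 0).
Proof.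
apply/idP/eqP => [|->//]; rewrite -eqz_nat eis_normE /eis_normz => /eqP h.
have h2 : x.2 = 0 by apply/eqP; rewrite -sqrf_eq0; apply/eqP; nra.
have h1 : x.1 = 0 by apply/eqP; rewrite -sqrf_eq0; apply/eqP; nra.
exact: injective_projections.
Qed.

Lemma eis_mul_conj x : x * eis_conj x = (eis_normz x, 0).
Proof. by apply: injective_projections => /=; rewrite /eis_normz; ring. Qed.

Definition eis_unit : pred eis := fun x => eis_norm x == 1.
(** An element of norm 1 is inverted by its conjugate; non-units keep the default value [x]. *)
Definition eis_inv (x : eis) : eis := if eis_unit x then eis_conj x else x.

Fact eis_mulVx : {in eis_unit, left_inverse 1 eis_inv *%R}.
Proof.
move=> x xU; rewrite /eis_inv (xU : eis_unit x) mulrC eis_mul_conj -eis_normE.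
by rewrite (eqP (xU : eis_unit x)).
Qed.

Fact eis_unitP (x y : eis) : y * x = 1 -> eis_unit x.
Proof.
move/(congr1 eis_norm); rewrite eis_normM => /eqP.
by rewrite muln_eq1 => /andP[].
Qed.

Fact eis_inv_out : {in [predC eis_unit], eis_inv =1 id}.
Proof. by move=> x; rewrite inE /eis_inv => /negPf xU; rewrite ifN //; apply/negbT. Qed.

HB.instance Definition _ := GRing.ComNzRing_hasMulInverse.Build eis
  eis_mulVx eis_unitP eis_inv_out.

Fact eis_idomain : GRing.integral_domain_axiom eis.
Proof.
move=> x y /eqP; rewrite -!eis_norm_eq0 eis_normM muln_eq0; by [].
Qed.
HB.instance Definition _ := GRing.ComUnitRing_isIntegral.Build eis eis_idomain.

Lemma eis_unitE (x : eis) : (x \is a GRing.unit) = (eis_norm x == 1).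
Proof. by []. Qed.

(** * Euclidean division and the Bezout property *)

Lemma int_round (n d : int) : 0 < d -> exists k : int, `|n - k * d| *+ 2 <= d.
Proof.
(* The floor of [n / d + 1 / 2], an integer nearest to [n / d]. *)
move=> d0; exists ((n *+ 2 + d) %/ (d *+ 2))%Z.
have d20 : d *+ 2 != 0 by lia.
have := divz_eq (n *+ 2 + d) (d *+ 2); have := modz_ge0 (n *+ 2 + d) d20.
have := ltz_mod (n *+ 2 + d) d20; lia.
Qed.

(* Rounding both coordinates of a * conj b / N b leaves remainders bounded
   by 1/2, of norm at most 3/4. *)
Lemma eis_division (a b : eis) : b != 0 ->
  exists q, (eis_norm (a - q * b)%R < eis_norm b)%N.
Proof.
move=> b0; have Nb : 0 < eis_normz b.
  by rewrite -eis_normE ltz_nat lt0n eis_norm_eq0.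
have [k1 h1] := int_round (a * eis_conj b).1 Nb.
have [k2 h2] := int_round (a * eis_conj b).2 Nb.
pose q : eis := (k1, k2); exists q; rewrite -ltz_nat !eis_normE -(ltr_pM2r Nb).
set c := a * eis_conj b in h1 h2.
(* The product is the norm of [(a - q * b) * eis_conj b], whose coordinates are the two rounding
   errors. *)
have -> : eis_normz (a - q * b) * eis_normz b =
   (c.1 - k1 * eis_normz b) ^+ 2
   - (c.1 - k1 * eis_normz b) * (c.2 - k2 * eis_normz b)
   + (c.2 - k2 * eis_normz b) ^+ 2.
  by rewrite /c /q /eis_normz /=; ring.
move: (c.1 - _) (c.2 - _) h1 h2 Nb => s t; move: (eis_normz b) => d.
move=> h1 h2 d0.
have sq (r : int) : `|r| *+ 2 <= d -> 4 * r ^+ 2 <= d ^+ 2.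
  by rewrite -[r ^+ 2]real_normK ?num_real //; have := normr_ge0 r; nra.
(* As [- s t <= (s^2 + t^2) / 2], the norm is at most [3/2 (s^2 + t^2) <= 3/4 d^2]. *)
have := sq s h1; have := sq t h2; have := sqr_ge0 (s + t).
by have := mulr_gt0 d0 d0; lra.
Qed.

Definition comaximal (R : comNzRingType) (a b : R) :=
  exists s t, s * a + t * b = 1.

Definition bezout_domain (R : idomainType) := forall a b : R,
  exists g a' b', [/\ a = a' * g, b = b' * g & comaximal a' b'].

Definition dvdr (R : comNzRingType) (a b : R) := exists q, b = q * a.

(** Euclid's algorithm, by induction on a bound for the norm of [b]; the Bezout relation between
    cofactors is carried along. *)
Lemma eis_bezout : bezout_domain eis.
Proof.
suff H n : forall a b : eis, (eis_norm b < n)%N ->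
    exists g a' b', [/\ a = a' * g, b = b' * g & comaximal a' b'].
  by move=> a b; apply: (H (eis_norm b).+1).
elim: n => // n IHn a b bn; have [->|b0] := eqVneq b 0.
  exists a, 1, 0; split; rewrite ?mul1r ?mul0r //.
  by exists 1, 0; rewrite mul1r mul0r addr0.
have [q hq] := eis_division a b0.
have [g [b' [r' [hb hr [s [t st]]]]]] :=
  IHn b (a - q * b) (leq_trans hq bn).
exists g, (r' + q * b'), b'; split => //.
  by rewrite mulrDl -hr -mulrA -hb subrK.
by exists t, (s - t * q); rewrite -st; ring.
Qed.

(** * Coprimality and Gauss's lemma in commutative rings *)

Section Comaximal.
Variable R : comNzRingType.
Implicit Types a b c : R.

Lemma comaximalC a b : comaximal a b -> comaximal b a.
Proof. by move=> [s [t h]]; exists t, s; rewrite addrC. Qed.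

Lemma comaximalMr a b c : comaximal a b -> comaximal a c -> comaximal a (b * c).
Proof.
move=> [s [t h1]] [s' [t' h2]].
exists (s + s' * t * b), (t * t').
by transitivity (s * a + t * b * (s' * a + t' * c)); [ring | rewrite h2 mulr1].
Qed.

Lemma comaximal1r a : comaximal a 1.
Proof. by exists 0, 1; rewrite mul0r mul1r add0r. Qed.

Lemma comaximalXr a b n : comaximal a b -> comaximal a (b ^+ n).
Proof.
move=> ab; elim: n => [|n IHn]; first exact: comaximal1r.
by rewrite exprS; apply: comaximalMr.
Qed.

Lemma comaximal_mulr a b c : comaximal a (b * c) -> comaximal a b.
Proof. by move=> [s [t h]]; exists s, (t * c); rewrite -h mulrAC mulrA. Qed.

Lemma gauss_dvdr a b c : comaximal a b -> dvdr a (b * c) -> dvdr a c.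
Proof.
move=> [s [t h]] [q hq]; exists (s * c + t * q).
by rewrite -[LHS]mul1r -h mulrDl -[t * b * c]mulrA hq; ring.
Qed.

Lemma comaximal_dvdr_unit a b : comaximal a b -> dvdr a b -> dvdr a 1.
Proof. by move=> [s [t h]] [q hq]; exists (s + t * q); rewrite -h hq; ring. Qed.

End Comaximal.

(** * Cubes in Bezout domains *)

Section BezoutDomain.
Variable R : idomainType.
Hypothesis bezoutR : bezout_domain R.
Implicit Types a b c : R.

Lemma dvdr1_unit a : dvdr a 1 -> a \is a GRing.unit.
Proof. by move=> [q hq]; apply/unitrPr; exists q; rewrite mulrC. Qed.

(* With d = gcd(a, c), a = a' d and c = c' d, cancelling d in a b = c^3 shows
   that a' divides d^2, while d^2 divides a' since d is prime to b. *)
Lemma comaximal_mul_cube a b c : a != 0 -> comaximal a b -> a * b = c ^+ 3 ->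
  exists e r, e \is a GRing.unit /\ a = e * r ^+ 3.
Proof.
move=> a0 ab abc; have [d [a' [c' [ha hc a'c']]]] := bezoutR a c.
have d0 : d != 0 by apply: contraNneq a0 => d0; rewrite ha d0 mulr0.
have a'0 : a' != 0 by apply: contraNneq a0 => a'0; rewrite ha a'0 mul0r.
have e1 : a' * b = c' ^+ 3 * d ^+ 2.
  by apply: (mulIf d0); move: abc; rewrite ha hc => h; rewrite mulrAC h; ring.
have [q hq] : dvdr a' (d ^+ 2).
  apply: (@gauss_dvdr _ _ (c' ^+ 3)); first exact: comaximalXr.
  by rewrite -e1; exists b; rewrite mulrC.
have [w hw] : dvdr (d ^+ 2) a'.
  apply: (@gauss_dvdr _ _ b); last first.
    by rewrite mulrC e1; exists (c' ^+ 3).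
  apply/comaximalC/comaximalXr/(@comaximal_mulr _ _ _ a')/comaximalC.
  by rewrite mulrC -ha.
exists w, d; split; last by rewrite ha hw -mulrA -exprSr.
apply/unitrPr; exists q; apply: (mulIf a'0).
by rewrite -mulrA -hq -hw mul1r.
Qed.

(** In lowest terms, [a'] divides the cube of [b'] and conversely, so coprimality makes both units
    and [e] is the cube of [b' / a']. *)
Lemma unit_of_cube_ratio e a b : e \is a GRing.unit -> b != 0 ->
  e * a ^+ 3 = b ^+ 3 -> exists f, f \is a GRing.unit /\ e = f ^+ 3.
Proof.
move=> eU b0 eab; have [d [a' [b' [ha hb a'b']]]] := bezoutR a b.
have d0 : d != 0 by apply: contraNneq b0 => d0; rewrite hb d0 mulr0.
have eab' : e * a' ^+ 3 = b' ^+ 3.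
  apply: (mulIf (expf_neq0 3 d0)).
  by rewrite -mulrA -!exprMn -ha -hb.
have a'U : a' \is a GRing.unit.
  apply/dvdr1_unit/(@comaximal_dvdr_unit _ _ (b' ^+ 3)).
    exact: comaximalXr.
  by exists (e * a' ^+ 2); rewrite -eab'; ring.
have b'U : b' \is a GRing.unit.
  apply/dvdr1_unit/(@comaximal_dvdr_unit _ _ (a' ^+ 3)).
    exact/comaximalXr/comaximalC.
  exists (e^-1 * b' ^+ 2); rewrite -mulrA -exprSr -eab' mulrA mulVr //.
  by rewrite mul1r.
exists (b' / a'); split; first by rewrite unitrM b'U unitrV.
by rewrite exprMn exprVn -eab' mulrK // unitrX.
Qed.
End BezoutDomain.

(** * Primes and units of the Eisenstein integers *)

Lemma eis_normX x n : eis_norm (x ^+ n) = (eis_norm x ^ n)%N.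
Proof. by elim: n => // n IHn; rewrite exprS eis_normM IHn expnS. Qed.

Lemma eis_norm_dvd a b : dvdr a b -> (eis_norm a %| eis_norm b)%N.
Proof. by move=> [q ->]; rewrite eis_normM dvdn_mull. Qed.

(** The norm of the gcd [g] divides a prime, so either [g] or the cofactor of [q] is a unit. *)
Lemma eis_prime q a : prime (eis_norm q) -> comaximal q a \/ dvdr q a.
Proof.
move=> qP; have [g [q' [a' [hq ha [s [t st]]]]]] := eis_bezout q a.
have qN : eis_norm q = (eis_norm q' * eis_norm g)%N by rewrite hq eis_normM.
have /primeP[_ /(_ (eis_norm g))] := qP.
rewrite qN dvdn_mull // => /(_ isT) /orP[] gE.
- have gU : g \is a GRing.unit by rewrite eis_unitE.
  left; exists (s / g), (t / g); rewrite -st hq ha.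
  by rewrite -!mulrA !(mulrC g^-1) !mulrK.
- right; have q'U : q' \is a GRing.unit.
    rewrite eis_unitE; have g0 : (0 < eis_norm g)%N.
      rewrite lt0n; apply: contraTneq qP => g0.
      by rewrite qN g0 muln0.
    by rewrite -(eqn_pmul2r g0) mul1n eq_sym.
  by exists (a' / q'); rewrite hq mulrA mulrVK.
Qed.

(** Splits each of the six units into a sign [d], which is its own cube, and a cube root of unity
    [k]. *)
Lemma eis_unit_sign (e : eis) : e \is a GRing.unit -> exists d k : eis,
  [/\ d ^+ 2 = 1, k = 1 \/ k ^+ 2 + k + 1 = 0 & e = d * k].
Proof.
rewrite eis_unitE => /eqP eN.
have := eis_normE e; rewrite eN; case: e {eN} => a b; rewrite /eis_normz /= => h.
(* Four times the norm is [(2a - b)^2 + 3b^2], and likewise with [a] and [b] exchanged. *)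
have [b1 b2] : -1 <= b /\ b <= 1 by split; nia.
have [a1 a2] : -1 <= a /\ a <= 1 by split; nia.
have ha : a = -1 \/ a = 0 \/ a = 1 by lia.
have hb : b = -1 \/ b = 0 \/ b = 1 by lia.
case: ha h {a1 a2} => [|[]] ->; case: hb {b1 b2} => [|[]] -> //= _.
- by exists 1, (-1, -1); split => //; right.
- by exists (- 1), 1; split => //; left.
- by exists (- 1), (0, 1); split => //; right.
- by exists 1, (0, 1); split => //; right.
- by exists 1, 1; split => //; left.
- by exists (- 1), (-1, -1); split => //; right.
Qed.

Lemma eis_unit_exp6 (e : eis) : e \is a GRing.unit -> (e ^+ 3) ^+ 2 = 1.
Proof.
move=> /eis_unit_sign[d [k [d2 hk ->]]].
have k3 : k ^+ 3 = 1.
  case: hk => [->|hk]; first exact: expr1n.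
  apply/eqP; rewrite -subr_eq0; apply/eqP.
  by transitivity ((k - 1) * (k ^+ 2 + k + 1)); [ring | rewrite hk mulr0].
by rewrite [(d * k) ^+ 3]exprMn k3 mulr1 -exprM mulnC exprM d2 expr1n.
Qed.

(** * Evaluation at a root of [X^2 + X + 1], and residues modulo [q] *)

(** Substitutes [k] for omega. With [k] in ['F_p] this will be reduction modulo [q]; with [k = u],
    the embedding into [C]. *)
Definition eis_eval (R : comNzRingType) (k : R) (x : eis) : R :=
  x.1%:~R + x.2%:~R * k.

Section Eval.
Variables (R : comNzRingType) (k : R).
Hypothesis hk : k ^+ 2 + k + 1 = 0.

Lemma eis_evalD : {morph eis_eval k : x y / x + y}.
Proof. by move=> x y; rewrite /eis_eval /= !rmorphD /=; ring. Qed.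

Lemma eis_evalM : {morph eis_eval k : x y / x * y}.
Proof.
move=> x y; rewrite /eis_eval /= !(rmorphD, rmorphN, rmorphM) /=.
apply/eqP; rewrite -subr_eq0; apply/eqP.
transitivity (- (x.2%:~R * y.2%:~R * (k ^+ 2 + k + 1))); first by ring.
by rewrite hk mulr0 oppr0.
Qed.

Lemma eis_eval1 : eis_eval k 1 = 1.
Proof. by rewrite /eis_eval /= mul0r addr0. Qed.

Lemma eis_eval0 : eis_eval k 0 = 0.
Proof. by rewrite /eis_eval /= mul0r addr0. Qed.

Lemma eis_evalX n : {morph eis_eval k : x / x ^+ n}.
Proof.
by move=> x; elim: n => [|n IHn]; [exact: eis_eval1 | rewrite !exprS eis_evalM IHn].
Qed.

End Eval.

(** The root is [- c / d], because [c^2 - c d + d^2] is the norm [p], zero in ['F_p]. If [d]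
    vanished so would [c], and [p^2] would divide [p]. *)
Lemma eis_residue p q : prime p -> eis_norm q = p ->
  exists k : 'F_p, k ^+ 2 + k + 1 = 0 /\ eis_eval k q = 0.
Proof.
move=> pP qN; have chp := pchar_Fp pP.
have int0 (n : int) : (n%:~R == 0 :> 'F_p) = (p %| n)%Z.
  by rewrite (dvdz_pcharf chp).
set c : 'F_p := q.1%:~R; set d : 'F_p := q.2%:~R.
have cd : c ^+ 2 - c * d + d ^+ 2 = 0.
  transitivity ((eis_normz q)%:~R : 'F_p).
    by rewrite /eis_normz !(rmorphD, rmorphN, rmorphM) /= !expr2.
  by apply/eqP; rewrite int0 -eis_normE qN.
have d0 : d != 0.
  apply/eqP => d0; have c0 : c = 0.
    by apply/eqP; rewrite -sqrf_eq0 -cd d0; apply/eqP; ring.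
  move/eqP: c0; move/eqP: d0; rewrite !int0 => /dvdzP[b hb] /dvdzP[a ha].
  have /(congr1 (@absz)) : p%:Z * ((a ^+ 2 - a * b + b ^+ 2) * p%:Z) = p%:Z * 1.
    by rewrite mulr1 -[RHS]/(Posz p) -{3}qN eis_normE /eis_normz ha hb; ring.
  rewrite !abszM => /eqP; rewrite eqn_pmul2l ?prime_gt0 // muln_eq1.
  by move=> /andP[_]; rewrite absz_nat => /eqP p1; rewrite p1 in pP.
exists (- c / d); split; last by rewrite /eis_eval -/c -/d; field.
transitivity ((c ^+ 2 - c * d + d ^+ 2) / d ^+ 2); first by field.
by rewrite cd mul0r.
Qed.

(** A root has [c^9 = 1]; as [p - 1] is 3 or 6 modulo 9, Fermat gives [c^3 = 1]. The sum is then 3,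
    which forces [p = 3]. *)
Lemma Fp_no_ninth_root p (c : 'F_p) : prime p ->
  (p = 4 %[mod 9])%N \/ (p = 7 %[mod 9])%N -> c ^+ 6 + c ^+ 3 + 1 != 0.
Proof.
move=> pP hmod; apply/eqP => hc.
have c9 : c ^+ 9 = 1.
  apply/eqP; rewrite -subr_eq0; apply/eqP.
  transitivity ((c ^+ 3 - 1) * (c ^+ 6 + c ^+ 3 + 1)); first by ring.
  by rewrite hc mulr0.
have c0 : c != 0.
  by apply/eqP => c0; move: c9; rewrite c0 expr0n => /eqP; rewrite eq_sym oner_eq0.
have cp : c ^+ p.-1 = 1.
  apply: (mulfI c0); rewrite -exprS prednK ?prime_gt0 // mulr1.
  by rewrite -[RHS](expf_card c) card_Fp.
have c3 : c ^+ 3 = 1.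
  have : c ^+ (p.-1 %% 9) = 1.
    by move: cp; rewrite {1}(divn_eq p.-1 9) exprD mulnC exprM c9 expr1n mul1r.
  have [->|-> c6] : (p.-1 %% 9 = 3 \/ p.-1 %% 9 = 6)%N by have := prime_gt1 pP; lia.
    by [].
  by rewrite -[LHS]mul1r -{1}c6 -exprD.
have : (3 %% p == 0)%N.
  have : (3%:R == 0 :> 'F_p).
    by rewrite -hc -[6%N]/(3 * 2)%N exprM c3 expr1n; apply/eqP; ring.
  by rewrite -(dvdn_pcharf (pchar_Fp pP)).
rewrite -[_ == _]/(p %| 3)%N dvdn_prime2 // => /eqP p3.
by case: hmod; rewrite p3.
Qed.

(** If [e] is not a sign, its part [l] is a primitive cube root of unity. The sign [d] being a cube,
    the image of [l] is the cube of [f d * c], a root of [X^6 + X^3 + 1]. *)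
Lemma eis_unit_cubic_residue p (k : 'F_p) (e : eis) c : prime p ->
  (p = 4 %[mod 9])%N \/ (p = 7 %[mod 9])%N -> k ^+ 2 + k + 1 = 0 ->
  e \is a GRing.unit -> eis_eval k e = c ^+ 3 -> e ^+ 2 = 1.
Proof.
move=> pP hmod hk /eis_unit_sign[d [l [d2 hl ->]]] hc.
case: hl => [->|hl]; first by rewrite mulr1.
set f := eis_eval k; have f2 : f d ^+ 2 = 1 by rewrite -eis_evalX // d2 eis_eval1.
have fl : f l ^+ 2 + f l + 1 = 0.
  by rewrite -(eis_evalX hk) -(eis_eval1 k) -!eis_evalD hl eis_eval0.
have flE : f l = (f d * c) ^+ 3.
  rewrite exprMn -hc (eis_evalM hk) -/f mulrA -exprSr.
  by rewrite -[4%N]/(2 * 2)%N exprM f2 expr1n mul1r.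
have := Fp_no_ninth_root (f d * c) pP hmod.
by rewrite -[6%N]/(3 * 2)%N exprM -flE fl eqxx.
Qed.

Lemma comaximal_unitr (R : comUnitRingType) (a e : R) :
  e \is a GRing.unit -> comaximal a e.
Proof. by move=> eU; exists 0, e^-1; rewrite mul0r add0r mulVr. Qed.

Lemma comaximal_dvdr (R : comNzRingType) (a b c : R) :
  comaximal a b -> dvdr c b -> comaximal a c.
Proof. by move=> ab [q hq]; apply: (@comaximal_mulr _ _ _ q); rewrite mulrC -hq. Qed.

Lemma comaximal_sum0 (R : comNzRingType) (a b c : R) :
  a + b + c = 0 -> comaximal a b -> comaximal a c.
Proof.
move=> /eqP; rewrite addr_eq0 => /eqP abc [s [t h]].
exists (s - t), (- t); rewrite -h.
transitivity ((s - t) * a + t * (- c)); [ring | rewrite -abc; ring].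
Qed.

(** * The descent on [x^3 + y^3 = M z^3] *)

Section Descent.
Variables (p : nat) (q e : eis) (j : nat).
Hypotheses (pP : prime p) (hmod : (p = 4 %[mod 9])%N \/ (p = 7 %[mod 9])%N).
Hypotheses (qN : eis_norm q = p) (eU : e \is a GRing.unit) (j3 : (0 < j < 3)%N).

Let M := e * q ^+ j.

Let q_neq0 : q != 0.
Proof. by rewrite -eis_norm_eq0 qN -lt0n prime_gt0. Qed.

Let M_neq0 : M != 0.
Proof. by rewrite mulf_neq0 ?expf_neq0 //; apply: contraTneq eU => ->; rewrite unitr0. Qed.

Let M_norm : eis_norm M = (p ^ j)%N.
Proof. by rewrite eis_normM eis_normX qN (eqP (eU : eis_norm e == 1)) mul1n. Qed.

Let comaximalM a : comaximal a q -> comaximal a M.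
Proof. by move=> h; apply: comaximalMr; [exact: comaximal_unitr | exact: comaximalXr]. Qed.

Let prime_dvd_M l : prime l -> (l %| eis_norm M)%N -> l = p.
Proof.
move=> lP; rewrite M_norm Euclid_dvdX // => /andP[].
by rewrite dvdn_prime2 // => /eqP.
Qed.

Lemma descent_step_dvd a b c z : z != 0 -> a + b + c = 0 -> comaximal a b ->
  a * b * c = M * z ^+ 3 -> dvdr q c ->
  exists x y t, [/\ t != 0, x ^+ 3 + y ^+ 3 = M * t ^+ 3
    & (eis_norm t < eis_norm z)%N].
Proof.
move=> z0 abc0 ab abcM qc.
have ac := comaximal_sum0 abc0 ab.
have bc : comaximal b c.
  by apply: comaximal_sum0 (comaximalC ab); rewrite [b + a]addrC.
have [aq bq] := (comaximal_dvdr ac qc, comaximal_dvdr bc qc).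
(* [a * b] is prime to [q], hence to [M], while [M] divides [a * b * c]. *)
have [c' hc] : dvdr M c.
  apply: (@gauss_dvdr _ _ (a * b)); last by exists (z ^+ 3); rewrite abcM mulrC.
  by apply: comaximalMr; apply/comaximalC/comaximalM.
have abc' : a * b * c' = z ^+ 3.
  apply: (mulIf M_neq0); rewrite [RHS]mulrC -abcM.
  by rewrite [in RHS]hc mulrA.
have z3 : z ^+ 3 != 0 by rewrite expf_neq0.
have [a0 b0 c'0] : [/\ a != 0, b != 0 & c' != 0].
  by split; apply: contraNneq z3 => h; rewrite -abc' h ?(mul0r, mulr0).
have ac' : comaximal a c' by apply: comaximal_dvdr ac _; exists M; rewrite mulrC.
have bc' : comaximal b c' by apply: comaximal_dvdr bc _; exists M; rewrite mulrC.
have [e1 [r [e1U ha]]] := comaximal_mul_cube eis_bezout a0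
  (comaximalMr ab ac') (etrans (mulrA _ _ _) abc').
have [e2 [s [e2U hb]]] : exists e r : eis, e \is a GRing.unit /\ b = e * r ^+ 3.
  apply: (comaximal_mul_cube (b := a * c') (c := z) eis_bezout b0).
    exact: comaximalMr (comaximalC ab) bc'.
  by rewrite mulrCA mulrA.
have [e3 [t [e3U hc']]] : exists e r : eis, e \is a GRing.unit /\ c' = e * r ^+ 3.
  apply: (comaximal_mul_cube (b := a * b) (c := z) eis_bezout c'0).
    by apply: comaximalMr; apply: comaximalC.
  by rewrite mulrC.
have rstz : e1 * e2 * e3 * (r * s * t) ^+ 3 = z ^+ 3.
  by rewrite -abc' ha hb hc'; ring.
have eeeU : e1 * e2 * e3 \is a GRing.unit by rewrite !unitrM e1U e2U e3U.
have [f [fU hf]] := unit_of_cube_ratio eis_bezout eeeU z0 rstz.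
have [k [hk kq]] := eis_residue pP qN.
have modq x : dvdr q x -> eis_eval k x = 0.
  by move=> [y ->]; rewrite eis_evalM // kq mulr0.
have eval_neq0 x : comaximal x q -> eis_eval k x != 0.
  move=> [m [l /(congr1 (eis_eval k))]].
  rewrite eis_evalD !eis_evalM // kq mulr0 addr0 eis_eval1.
  by apply: contra_eqN => /eqP ->; rewrite mulr0 eq_sym oner_eq0.
have [e10 r0] : eis_eval k e1 != 0 /\ eis_eval k r ^+ 3 != 0.
  by apply/andP; rewrite -negb_or -mulf_eq0 -eis_evalX // -eis_evalM // -ha eval_neq0.
have s0 : eis_eval k s != 0.
  have := eval_neq0 _ bq; rewrite hb eis_evalM // eis_evalX // mulf_eq0 negb_or.
  by rewrite expf_eq0 => /andP[].
pose d := e2 / e1; have e2E : e2 = d * e1 by rewrite /d mulrVK.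
(* As [q] divides [c = - (a + b)], reduction gives [r^3 + d s^3 = 0] in ['F_p], so [d] becomes a
   cube there. *)
have d2 : d ^+ 2 = 1.
  apply: (eis_unit_cubic_residue (c := - (eis_eval k r / eis_eval k s)) pP hmod hk).
    by rewrite unitrM e2U unitrV.
  have : eis_eval k (a + b) = 0.
    apply: modq; have [y hy] := qc; exists (- y); rewrite mulNr -hy.
    by apply/eqP; rewrite -addr_eq0 abc0.
  have -> : a + b = e1 * (r ^+ 3 + d * s ^+ 3) by rewrite ha hb e2E; ring.
  rewrite !(eis_evalM hk, eis_evalD, eis_evalX hk) => /eqP.
  rewrite mulf_eq0 (negPf e10) /= addrC addr_eq0 => /eqP h.
  by apply: (mulIf (expf_neq0 3 s0)); rewrite h; field.
have f2 := eis_unit_exp6 fU; have e16 := eis_unit_exp6 e1U.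
(* Solving [e1 * e2 * e3 = f^3] with [e2 = d * e1], [d^2 = 1] and [e1^6 = 1] gives [e3 = n * e1],
   where [n] is a product of signs. *)
pose n := f ^+ 3 * d * e1 ^+ 3.
have n2 : n ^+ 2 = 1.
  by rewrite /n exprMn [(f ^+ 3 * d) ^+ 2]exprMn f2 d2 e16 !mul1r.
have e3E : e3 = n * e1.
  transitivity (d ^+ 2 * (e1 ^+ 3) ^+ 2 * e3); first by rewrite d2 e16 !mul1r.
  by rewrite /n -hf e2E; ring.
have NU (x : eis) m : x ^+ m.+1 = 1 -> eis_norm x = 1.
  move/(congr1 eis_norm); rewrite eis_normX -[RHS](exp1n m.+1) => /eqP.
  by rewrite eqn_exp2r // => /eqP.
(* This is [a + b + c = 0] divided by [e1]; since [d^3 = d] and [n^3 = n], the signs move inside the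
   cubes. *)
have rst0 : r ^+ 3 + (d * s) ^+ 3 = M * (- n * t) ^+ 3.
  apply/eqP; rewrite -subr_eq0; apply/eqP/(mulfI (_ : e1 != 0)).
    by apply: contraTneq e1U => ->; rewrite unitr0.
  rewrite mulr0 -[RHS]abc0 hc hc' ha hb e2E e3E.
  have -> : (d * s) ^+ 3 = d ^+ 2 * d * s ^+ 3 by ring.
  have -> : (- n * t) ^+ 3 = - (n ^+ 2 * n * t ^+ 3) by ring.
  by rewrite d2 n2; ring.
have t0 : t != 0.
  by apply: contraNneq c'0; rewrite hc' => ->; rewrite expr0n mulr0.
exists r, (d * s), (- n * t); split=> //.
  rewrite mulf_neq0 // oppr_eq0.
  by apply/eqP => n0; move: n2; rewrite n0 expr0n => /eqP; rewrite eq_sym oner_eq0.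
have zN : eis_norm z = (eis_norm r * eis_norm s * eis_norm t)%N.
  have := congr1 eis_norm rstz; rewrite eis_normM (eqP (eeeU : eis_norm _ == 1)).
  rewrite !eis_normX mul1n -!eis_normM => /eqP.
  by rewrite eqn_exp2r // => /eqP.
have nt : eis_norm (- n * t) = eis_norm t.
  by rewrite eis_normM (@NU (- n) 1%N) ?mul1n // sqrrN.
(* If the norm did not drop, [r] and [s] would be units and both cubes signs. Their sum is nonzero,
   hence equal to [2 * r^3] of norm 4, so [p] would divide 4. *)
rewrite nt ltnNge zN; apply/negP => rst1.
have pos (x : eis) : x != 0 -> (0 < eis_norm x)%N by rewrite lt0n eis_norm_eq0.
have rs1 : (eis_norm r * eis_norm s == 1)%N.
  move: rst1; rewrite -{2}[eis_norm t]mul1n leq_pmul2r ?pos // => rst1.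
  rewrite eqn_leq rst1 muln_gt0 !pos //.
    by apply: contraNneq b0; rewrite hb => ->; rewrite expr0n mulr0.
  by apply: contraNneq a0; rewrite ha => ->; rewrite expr0n mulr0.
move: rs1; rewrite muln_eq1 => /andP[rU sU].
have r2 := eis_unit_exp6 (rU : r \is a GRing.unit).
have ds2 : ((d * s) ^+ 3) ^+ 2 = 1.
  by apply: eis_unit_exp6; rewrite eis_unitE eis_normM (eqP sU) (@NU d 1%N).
have T0 : M * (- n * t) ^+ 3 != 0.
  by rewrite mulf_neq0 // expf_neq0 // -eis_norm_eq0 nt eis_norm_eq0.
have rds : r ^+ 3 = (d * s) ^+ 3.
  apply/eqP; rewrite -subr_eq0 -(mulrI_eq0 _ (mulfI T0)) -rst0.
  by rewrite mulrC -subr_sqr r2 ds2 subrr.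
have /(congr1 eis_norm) : M * (- n * t) ^+ 3 = 2 * r ^+ 3 by rewrite -rst0 -rds; ring.
rewrite (eis_normM M) (eis_normM 2) (@NU (r ^+ 3) 1%N) // M_norm => N4.
have : (p %| 2 ^ 2)%N.
  rewrite -[(2 ^ 2)%N]/(eis_norm 2%R * 1)%N -N4 dvdn_mulr // dvdn_exp //.
  by case/andP: j3.
rewrite Euclid_dvdX // dvdn_prime2 // => /andP[/eqP p2 _].
by case: hmod; rewrite p2.
Qed.
(** As [j > 0], [q] divides [a * b * c], hence one factor, which by symmetry can be put last. *)
Lemma descent_step a b c z : z != 0 -> a + b + c = 0 -> comaximal a b ->
  a * b * c = M * z ^+ 3 ->
  exists x y t, [/\ t != 0, x ^+ 3 + y ^+ 3 = M * t ^+ 3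
    & (eis_norm t < eis_norm z)%N].
Proof.
move=> z0 abc0 ab abcM; have qP : prime (eis_norm q) by rewrite qN.
have ac := comaximal_sum0 abc0 ab.
have bc : comaximal b c.
  by apply: comaximal_sum0 (comaximalC ab); rewrite [b + a]addrC.
have [qa|qa] := eis_prime a qP; last first.
  by apply: (descent_step_dvd z0 _ bc _ qa); [rewrite -abc0; ring | rewrite -abcM; ring].
have [qb|qb] := eis_prime b qP; last first.
  apply: (descent_step_dvd z0 _ (comaximalC ac) _ qb).
    by rewrite -abc0; ring.
  by rewrite -abcM; ring.
apply: (descent_step_dvd z0 abc0 ab abcM).
apply: (@gauss_dvdr _ _ (a * b)); first exact: comaximalMr.
rewrite abcM /M; exists (e * q ^+ j.-1 * z ^+ 3).
by case/andP: j3; case: (j) => // n _ _; rewrite exprS; ring.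
Qed.

(* The pairwise gcd of the three factors of x^3 + y^3 divides
   l = 1 + 2 omega = sqrt (-3), which is prime. *)
Lemma descent_comaximal x y z : z != 0 -> comaximal x y ->
  x ^+ 3 + y ^+ 3 = M * z ^+ 3 ->
  exists x y t, [/\ t != 0, x ^+ 3 + y ^+ 3 = M * t ^+ 3
    & (eis_norm t < eis_norm z)%N].
Proof.
move=> z0 [s [t st]] xyz; pose w : eis := (0, 1); pose l : eis := (1, 2).
(* Here [- (1 + w)] is omega^2: the factors are [x + y], [omega x + omega^2 y] and
   [omega^2 x + omega y]. *)
pose a := x + y; pose b := w * x - (1 + w) * y; pose c := w * y - (1 + w) * x.
have abc0 : a + b + c = 0 by rewrite /a /b /c; ring.
have abcE : a * b * c = x ^+ 3 + y ^+ 3.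
  rewrite /a /b /c; case: (x) (y) => [x1 x2] [y1 y2].
  by rewrite !exprS expr0; apply: injective_projections => /=; ring.
(* Combines [l x = (1 + w) a + b] and [l y = w a - b] through [s x + t y = 1]. *)
have lE : l = (s * (1 + w) + t * w) * a + (s - t) * b.
  transitivity (l * (s * x + t * y)); first by rewrite st mulr1.
  have -> : l = 1 + 2 * w by [].
  by rewrite /a /b; ring.
have lP : prime (eis_norm l) by [].
have [la|[a' ha]] := eis_prime a lP.
  have ab : comaximal a b.
    have [m [n mn]] := la.
    exists (n + m * (s * (1 + w) + t * w)), (m * (s - t)).
    by rewrite -[RHS]mn lE; ring.
  by apply: descent_step z0 abc0 ab _; rewrite abcE.
have bE : b = (x - (1 + w) * a') * l.
  rewrite mulrBl -mulrA -ha; have -> : l = 1 + 2 * w by [].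
  by rewrite /a /b; ring.
set b' := x - (1 + w) * a' in bE.
have cE : c = (- a' - b') * l.
  by rewrite mulrBl mulNr -ha -bE; apply/eqP; rewrite -subr_eq0 -abc0; apply/eqP; ring.
have l0 : l != 0 by [].
(* [l] now divides all three factors. Were it prime to [z], it would divide [M], and its norm 3
   would be [p]. *)
have [lz|[z' hz]] := eis_prime z lP.
  have /eis_norm_dvd/(prime_dvd_M lP) p3 : dvdr l M.
    apply: (@gauss_dvdr _ _ (z ^+ 3)); first exact: comaximalXr.
    by rewrite mulrC -xyz -abcE cE; exists (a * b * (- a' - b')); rewrite mulrA.
  by case: hmod; rewrite -p3.
have z'0 : z' != 0 by apply: contraNneq z0; rewrite hz => ->; rewrite mul0r.
(* The equation is divided by [l^3]; cancelling [l] in [lE] makes [a'] and [b'] comaximal. *)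
have [| | |x1 [y1 [t1 [t10 h1 h2]]]] := @descent_step a' b' (- a' - b') z' z'0.
- by ring.
- exists (s * (1 + w) + t * w), (s - t).
  by apply: (mulIf l0); rewrite mul1r mulrDl -!mulrA -ha -bE -lE.
- apply: (mulIf (expf_neq0 3 l0)); rewrite -[RHS]mulrA -exprMn -hz -xyz -abcE cE bE ha.
  by ring.
exists x1, y1, t1; split=> //; apply: leq_trans h2 _.
by rewrite hz eis_normM leq_pmulr.
Qed.

(** Induction on the norm of [z], after making [x] and [y] coprime: reducing [g / z] to [g' / z'],
    the cube of [g'] divides [M] of norm [p^j] with [j < 3], so [g'] is a unit and is absorbed into
    [z']. *)
Theorem eis_no_sum_cubes x y z : z != 0 -> x ^+ 3 + y ^+ 3 <> M * z ^+ 3.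
Proof.
move: {2}(eis_norm z).+1 (ltnSn (eis_norm z)) => n.
elim: n x y z => // n IHn x y z zn z0 xyz.
have [g [x' [y' [hx hy xy']]]] := eis_bezout x y.
have [d [g' [z' [hg hz gz']]]] := eis_bezout g z.
have d0 : d != 0 by apply: contraNneq z0; rewrite hz => ->; rewrite mulr0.
have z'0 : z' != 0 by apply: contraNneq z0; rewrite hz => ->; rewrite mul0r.
have xyz' : g' ^+ 3 * (x' ^+ 3 + y' ^+ 3) = M * z' ^+ 3.
  apply: (mulIf (expf_neq0 3 d0)); rewrite -[RHS]mulrA -exprMn -hz -xyz hx hy hg.
  by ring.
have g'U : g' \is a GRing.unit.
  have /eis_norm_dvd : dvdr (g' ^+ 3) M.
    apply: (@gauss_dvdr _ _ (z' ^+ 3)); last first.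
      by exists (x' ^+ 3 + y' ^+ 3); rewrite mulrC -xyz' mulrC.
    by apply/comaximalXr/comaximalC/comaximalXr/comaximalC.
  rewrite M_norm eis_normX => gp.
  have /(dvdn_pfactor _ _ pP)[i _ gi] : (eis_norm g' %| p ^ j)%N.
    by apply: dvdn_trans gp; apply: dvdn_exp.
  move: gp; rewrite gi -expnM dvdn_Pexp2l ?prime_gt1 // => ij.
  have i0 : i = 0 by case/andP: j3; lia.
  by rewrite eis_unitE gi i0.
have zg0 : z' / g' != 0 by rewrite mulf_neq0 // invr_eq0; apply: contraTneq g'U => ->; rewrite unitr0.
have xyzg : x' ^+ 3 + y' ^+ 3 = M * (z' / g') ^+ 3.
  by rewrite exprMn mulrA -xyz' exprVn mulrAC mulrV ?unitrX // mul1r.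
have [x1 [y1 [t [t0 h1 h2]]]] := descent_comaximal zg0 xy' xyzg.
apply: (IHn x1 y1 t) => //; apply: leq_trans h2 _; rewrite -ltnS.
apply: leq_trans zn; rewrite ltnS eis_normM hz eis_normM.
have := g'U; rewrite -unitrV eis_unitE => /eqP ->.
by rewrite muln1 leq_pmulr // lt0n eis_norm_eq0.
Qed.

End Descent.

(** * Eisenstein integers as elements of [C] *)

Section Embedding.
Variables (C : numClosedFieldType) (u v : C).
Hypotheses (hu : root ('X^2 + 'X + 1) u) (hv : root ('X^2 + 'X + 1) v).
Hypothesis huv : u <> v.

Let root_eq (w : C) : root ('X^2 + 'X + 1) w -> w ^+ 2 + w + 1 = 0.
Proof. by move=> /rootP; rewrite !hornerE. Qed.

Let hu0 := root_eq hu.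

Let sum_roots (w : C) : w ^+ 2 + w + 1 = 0 -> w != u -> w = - u - 1.
Proof.
move=> hw wu; apply/eqP; rewrite -subr_eq0; apply/eqP.
have wu0 : w - u != 0 by rewrite subr_eq0.
apply: (mulfI wu0); rewrite mulr0.
transitivity ((w ^+ 2 + w + 1) - (u ^+ 2 + u + 1)); first by ring.
by rewrite hw hu0 subrr.
Qed.

Let vE : v = - u - 1.
Proof. by apply: sum_roots (root_eq hv) _; apply/eqP => /esym. Qed.

(** The conjugate is a root too, and [u] is not real because the square of [2 * u + 1] is [- 3]. *)
Let conj_u : u^* = - u - 1.
Proof.
apply: sum_roots.
  by rewrite -rmorphXn -[1](rmorph1 (@Num.conj C)) -!rmorphD /= hu0 rmorph0.
apply/negP => ur; have uR : u \is Num.real by rewrite CrealE.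
have wR : 2 * u + 1 \is Num.real by rewrite realD ?realM ?real1 ?realn.
have := real_exprn_even_ge0 wR (isT : ~~ odd 2).
have -> : (2 * u + 1) ^+ 2 = - 3 :> C.
  transitivity (4 * (u ^+ 2 + u + 1) - 3); first by ring.
  by rewrite hu0 mulr0 sub0r.
by rewrite oppr_ge0 lern0.
Qed.

Lemma in_O_eval w : in_O u v w -> exists x, w = eis_eval u x.
Proof.
move=> [a [b [c ->]]]; exists (a - c, b - c).
by rewrite /eis_eval vE /= !rmorphB /=; ring.
Qed.

Lemma in_K_eval w : in_K u v w ->
  exists x (n : int), n != 0 /\ w * n%:~R = eis_eval u x.
Proof.
move=> [a [b [c ->]]]; rewrite /ratr vE.
have D0 (r : rat) : (denq r)%:~R != 0 :> C by rewrite intr_eq0 denq_neq0.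
(* The coordinates [a - c] and [b - c] in the basis [1, u], times the product of the
   denominators. *)
exists (numq a * denq b * denq c - numq c * denq a * denq b,
        numq b * denq a * denq c - numq c * denq a * denq b),
       (denq a * denq b * denq c); split; first by rewrite !mulf_neq0 ?denq_neq0.
rewrite /eis_eval /= !(rmorphB, rmorphM) /=.
by field; rewrite !D0.
Qed.

Lemma normN_eval x : normN (eis_eval u x) = (eis_norm x)%:R.
Proof.
rewrite /normN /eis_eval rmorphD rmorphM /= !rmorph_int conj_u.
rewrite -[RHS]/((eis_norm x)%:Z%:~R) eis_normE /eis_normz.
rewrite !(rmorphD, rmorphN, rmorphM, rmorphXn) /=.
apply/eqP; rewrite -subr_eq0; apply/eqP.
transitivity (- x.2%:~R ^+ 2 * (u ^+ 2 + u + 1)); first by ring.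
by rewrite hu0 mulr0.
Qed.

Lemma eis_eval_inj : injective (eis_eval u).
Proof.
move=> x y xy; apply/eqP.
rewrite -subr_eq0 -eis_norm_eq0 -(pnatr_eq0 C) -normN_eval.
have -> : eis_eval u (x - y) = 0.
  transitivity (eis_eval u x - eis_eval u y); last by rewrite xy subrr.
  by rewrite /eis_eval /= !rmorphB /=; ring.
by rewrite /normN mul0r.
Qed.

Lemma unit_O_eval w : unit_O u v w ->
  exists2 e : eis, e \is a GRing.unit & w = eis_eval u e.
Proof.
move=> [/in_O_eval[e ->]] [f /in_O_eval[g ->] eg]; exists e => //.
apply/unitrPr; exists g; apply: eis_eval_inj.
by rewrite eis_evalM // eg eis_eval1.
Qed.

End Embedding.

(** * Transfer of the result to [R[i]] *)

Local Open Scope complex_scope.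

Theorem theorem1p4 (R : realType) (u v : R[i])
    (hu : root ('X^2 + 'X + 1) u) (hv : root ('X^2 + 'X + 1) v) (huv : u <> v)
    (m : R[i]) (hm : irreducible_O u v m)
    (p : nat) (hp : prime p) (hN : normN m = p%:R)
    (hmod : (p = 4 %[mod 9])%N \/ (p = 7 %[mod 9])%N)
    (M : R[i]) (hM : associate_O u v M m \/ associate_O u v M (m ^+ 2)) :
  ~ exists x y : R[i], [/\ in_K u v x, in_K u v y & M = x ^+ 3 + y ^+ 3].
Proof.
have hu0 : u ^+ 2 + u + 1 = 0 by move/rootP: hu; rewrite !hornerE.
case: hm => /(in_O_eval hu hv huv)[q mE] _ _ _.
have qN : eis_norm q = p.
  apply/eqP; rewrite -(eqr_nat R[i]) -hN mE.
  by rewrite (normN_eval hu).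
have [j [e [j3 eU ME]]] : exists j (e : eis),
    [/\ (0 < j < 3)%N, e \is a GRing.unit & M = eis_eval u (e * q ^+ j)].
  case: hM => -[_ _ [w /(unit_O_eval hu hv huv)[e eU ->] ->] _].
  - by exists 1%N, e; rewrite eis_evalM // -mE.
  - by exists 2%N, e; rewrite eis_evalM // eis_evalX // -mE.
move=> [x [y [xK yK]]].
have [x' [a [a0 xE]]] := in_K_eval hu hv huv xK.
have [y' [b [b0 yE]]] := in_K_eval hu hv huv yK.
rewrite ME => Mxy.
have evalZ (n : int) : eis_eval u (n, 0) = n%:~R by rewrite /eis_eval /= mul0r addr0.
(* Clearing the denominators [a] and [b] of [x] and [y] gives an equation with [z = A * B]. *)
pose A : eis := (a, 0); pose B : eis := (b, 0).
have z0 : A * B != 0.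
  by rewrite mulf_neq0 // -eis_norm_eq0 /eis_norm /eis_normz /= mulr0 subr0 addr0
             absz_eq0 expf_eq0.
apply: (@eis_no_sum_cubes p q e j hp hmod qN eU j3 (x' * B) (y' * A) _ z0).
apply: (eis_eval_inj hu).
rewrite !(eis_evalD, eis_evalM hu0, eis_evalX hu0).
move: Mxy; rewrite eis_evalM // eis_evalX // !evalZ -xE -yE => ->.
by ring.
Qed.
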